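(* For every integer $n\geq 1$, $2n-4\leq \mathrm{ex}_{\mathcal{P}}(n,S_{2,3})\leq 2n$.
   Context: All graphs are finite and simple. For a graph $F$, the planar Turán number $\mathrm{ex}_{\mathcal{P}}(n,F)$ is the maximum number of edges in an $n$-vertex planar graph that contains no subgraph isomorphic to $F$. For positive integers $m,k$, the double star $S_{m,k}$ is the tree obtained from an edge $xy$ (the backbone) by joining $x$ to $m$ new vertices and $y$ to $k$ further new vertices, all these $m+k$ vertices distinct. *)

(* Defs.v *)
From Stdlib Require Import Reals.
From mathcomp Require Import all_boot.
Set Implicit Arguments. Unset Strict Implicit. Unset Printing Implicit Defensive.

Definition simple_graph (n : nat) (e : rel 'I_n) : Prop :=
  (forall u v, e u v = e v u) /\ (forall u, e u u = false).

Definition num_edges (n : nat) (e : rel 'I_n) : nat :=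
  #|[set p : 'I_n * 'I_n | (p.1 < p.2)%N && e p.1 p.2]|.

Definition planar (n : nat) (e : rel 'I_n) : Prop :=
  exists (pt : 'I_n -> (R * R)%type) (arc : 'I_n -> 'I_n -> R -> (R * R)%type),
    (forall u v, pt u = pt v -> u = v) /\
    (forall u v, e u v ->
       arc u v R0 = pt u /\ arc u v R1 = pt v /\
       continuity (fun t => fst (arc u v t)) /\
       continuity (fun t => snd (arc u v t)) /\
       (forall s t, (Rle R0 s /\ Rle s R1) -> (Rle R0 t /\ Rle t R1) ->
          arc u v s = arc u v t -> s = t) /\
       (forall w t, (Rlt R0 t /\ Rlt t R1) -> arc u v t <> pt w)) /\
    (forall u v u' v', e u v -> e u' v' ->
       ~ ((u = u' /\ v = v') \/ (u = v' /\ v = u')) ->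
       forall s t, (Rlt R0 s /\ Rlt s R1) -> (Rlt R0 t /\ Rlt t R1) -> arc u v s <> arc u' v' t).

Definition contains_double_star (m k : nat) (n : nat) (e : rel 'I_n) : Prop :=
  exists (x y : 'I_n) (A B : seq 'I_n),
    size A = m /\ size B = k /\ uniq (x :: y :: A ++ B) /\ e x y /\
    (forall a, a \in A -> e x a) /\ (forall b, b \in B -> e y b).

Definition is_planar_turan_double_star (a b n m : nat) : Prop :=
  (exists e : rel 'I_n, simple_graph e /\ planar e /\
     ~ contains_double_star a b e /\ num_edges e = m) /\
  (forall e : rel 'I_n, simple_graph e -> planar e ->
     ~ contains_double_star a b e -> (num_edges e <= m)%N).

(* Main.v *)
(** Lower bound: K_{2,n-2} has 2n-4 edges, and each of its edges has an endpoint
    of degree at most 2.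

    Upper bound: in an S_{2,3}-free graph a vertex of degree at least 6 has only
    neighbours of degree at most 2, and a neighbour of degree at least 3 of a
    vertex v of degree 5 has its whole neighbourhood inside N[v].  Hence either v
    has a neighbour of degree at most 2, or N[v] is a 6-vertex component.
    Discharging from the vertices of degree at most 2 gives average degree at
    most 4, provided a component N[v] has at most 12 edges; with 13 edges it
    would contain K_{3,3}.

    Nonplanarity of K_{3,3} is proved as in van Kampen's obstruction, without
    the Jordan curve theorem.  For disjoint arcs g and h the difference
    g(s) - h(t) avoids 0 on the unit square, so the signed number of crossings
    of the positive x-axis along the boundary of a fine enough grid vanishes.
    Summed over the 18 pairs of disjoint edges of K_{3,3}, these relations
    contradict each other modulo 2. *)

Require Import Defs.
From Stdlib Require Import Reals Lra Classical IndefiniteDescription.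
From mathcomp Require Import all_boot ssralg ssrint zify.
Set Implicit Arguments. Unset Strict Implicit. Unset Printing Implicit Defensive.
(* Both R_scope and ring_scope claim the key R. *)
Delimit Scope R_scope with Re.
Delimit Scope ring_scope with R.

(** * Signed crossings of the positive x-axis *)

Definition psub (p q : R * R) : R * R := (p.1 - q.1, p.2 - q.2)%Re.

Definition right (p : R * R) : bool := Rlt_dec 0 p.1.

(* For p <> 0 exactly one of p and -p is in this half-plane. *)
Definition upper (p : R * R) : bool :=
  if Rlt_dec 0 p.2 then true else if Req_dec_T p.2 0 then right p else false.

(* For nearby p and q: the signed crossing of the positive x-axis by [p, q]. *)
Definition crossing (p q : R * R) : int :=
  ((right p)%:Z * ((upper q)%:Z - (upper p)%:Z))%R.

Definition crossings (N : nat) (g : R -> R * R) : int :=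
  (\sum_(0 <= i < N)
     crossing (g (INR i / INR N)%Re) (g (INR i.+1 / INR N)%Re))%R.

(** A chord that changes half-plane stays on one side of the y-axis, so it does not matter which
    endpoint [crossing] tests with [right]. *)
Definition short_chord (p q : R * R) : Prop :=
  upper p <> upper q ->
  (0 < p.1 /\ 0 < q.1)%Re \/ (p.1 < 0 /\ q.1 < 0)%Re.

Lemma upper_psub p q : p <> q ->
  ((upper (psub q p))%:Z = 1 - (upper (psub p q))%:Z)%R.
Proof.
case: p q => [a b] [c d] ne; rewrite /upper /right /=.
do ! [case: Rlt_dec => /= ? | case: Req_dec_T => /= ?]; try (by []); try lra.
by case: ne; congr pair; lra.
Qed.

(* The two signed crossings of [p, q], with the positive and with the negative
   x-axis, add up to the change of half-plane. *)
Lemma crossing_psub p q p' q' :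
  p <> q -> p' <> q' -> short_chord (psub p q) (psub p' q') ->
  crossing (psub p q) (psub p' q') =
  (crossing (psub q p) (psub q' p')
   + (upper (psub p' q'))%:Z - (upper (psub p q))%:Z)%R.
Proof.
move=> ne ne'; rewrite /short_chord /crossing !(upper_psub ne) !(upper_psub ne').
case: (upper (psub p q)); case: (upper (psub p' q')) => // sc.
- by rewrite /right; do ! case: Rlt_dec.
- case: sc => //=; rewrite /right /=; do ! case: Rlt_dec => //= ?; lra.
- case: sc => //=; rewrite /right /=; do ! case: Rlt_dec => //= ?; lra.
- by rewrite /right; do ! case: Rlt_dec.
Qed.

(** If the three half-planes are not all equal, two of the chords change half-plane; then all three
    points lie on one side of the y-axis and the sum telescopes. *)
Lemma crossing_triangle p q r :
  short_chord p q -> short_chord q r -> short_chord p r ->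
  (crossing p q + crossing q r = crossing p r)%R.
Proof.
rewrite /short_chord /crossing /right.
case: (upper p); case: (upper q); case: (upper r) => // h1 h2 h3;
  do ! case: Rlt_dec => //= ?; exfalso;
  (case: h1 => //; lra) || (case: h2 => //; lra) || (case: h3 => //; lra).
Qed.

(** A diagonal cuts each cell into two triangles, so the signed sum around the cell vanishes;
    summing over the cells leaves the boundary of the square. *)
Lemma crossing_grid (F : nat -> nat -> R * R) (N : nat) :
  (forall i j i' j', i <= i' <= i.+1 -> j <= j' <= j.+1 -> i' <= N -> j' <= N ->
     short_chord (F i j) (F i' j')) ->
  (\sum_(0 <= i < N) crossing (F i N) (F i.+1 N)
   - \sum_(0 <= i < N) crossing (F i 0) (F i.+1 0)
   = \sum_(0 <= j < N) crossing (F N j) (F N j.+1)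
     - \sum_(0 <= j < N) crossing (F 0 j) (F 0 j.+1))%R.
Proof.
move=> sc.
pose h j : int := (\sum_(0 <= i < N) crossing (F i j) (F i.+1 j))%R.
rewrite -/(h N) -/(h 0) -(GRing.telescope_sumr h (leq0n N)) -GRing.sumrB.
apply: eq_big_nat => j /andP[_ jN].
pose v i : int := crossing (F i j) (F i j.+1).
rewrite -/(v N) -/(v 0) -(GRing.telescope_sumr v (leq0n N)) -GRing.sumrB.
apply: eq_big_nat => i /andP[_ iN]; rewrite /v.
have t1 : (crossing (F i j) (F i j.+1) + crossing (F i j.+1) (F i.+1 j.+1)
    = crossing (F i j) (F i.+1 j.+1))%R.
  by apply: crossing_triangle; apply: sc; lia.
have t2 : (crossing (F i j) (F i.+1 j) + crossing (F i.+1 j) (F i.+1 j.+1)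
    = crossing (F i j) (F i.+1 j.+1))%R.
  by apply: crossing_triangle; apply: sc; lia.
lia.
Qed.

(** * Disjoint paths and their crossing relation *)

Definition continuous_path (g : R -> R * R) : Prop :=
  continuity (fun t => (g t).1) /\ continuity (fun t => (g t).2).

Definition disjoint_paths (g h : R -> R * R) : Prop :=
  forall s t, (0 <= s <= 1)%Re -> (0 <= t <= 1)%Re -> g s <> h t.

Definition dist1 (p q : R * R) : R := (Rabs (p.1 - q.1) + Rabs (p.2 - q.2))%Re.

Lemma dist1_triangle p q r : (dist1 p r <= dist1 p q + dist1 q r)%Re.
Proof. by rewrite /dist1; split_Rabs; lra. Qed.

Lemma dist1_sym p q : dist1 p q = dist1 q p.
Proof. by rewrite /dist1; split_Rabs; lra. Qed.

Lemma dist1_continuous (g : R -> R * R) (p : R * R) :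
  continuous_path g -> continuity (fun t => dist1 (g t) p).
Proof.
case=> c1 c2; apply: continuity_plus.
- apply: (continuity_comp (fun t => (g t).1 - p.1)%Re Rabs); last exact: Rcontinuity_abs.
  by apply: continuity_minus => //; apply: continuity_const.
- apply: (continuity_comp (fun t => (g t).2 - p.2)%Re Rabs); last exact: Rcontinuity_abs.
  by apply: continuity_minus => //; apply: continuity_const.
Qed.

(** The distance is minimised first over t, then over s; the inner minimum [G] varies by at most
    [dist1 (g s) (g s')], hence is continuous. *)
Lemma disjoint_paths_gap (g h : R -> R * R) :
  continuous_path g -> continuous_path h -> disjoint_paths g h ->
  exists2 m, (0 < m)%Re &
    forall s t, (0 <= s <= 1)%Re -> (0 <= t <= 1)%Re -> (m <= dist1 (g s) (h t))%Re.
Proof.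
move=> cg ch dis.
have le01 : (0 <= 1)%Re by lra.
have min_h s : exists t, (forall c, (0 <= c <= 1)%Re ->
    (dist1 (h t) (g s) <= dist1 (h c) (g s))%Re) /\ (0 <= t <= 1)%Re.
  by apply: (continuity_ab_min (fun t => dist1 (h t) (g s))) => // c _; apply: dist1_continuous.
have [T HT] := functional_choice _ min_h.
pose G s := dist1 (g s) (h (T s)).
have G_le s s' : (G s <= G s' + dist1 (g s) (g s'))%Re.
  have [HTs _] := HT s; have [_ T01] := HT s'.
  have := HTs _ T01; have := dist1_triangle (g s) (g s') (h (T s')).
  by rewrite /G !(dist1_sym (g s)) (dist1_sym (g s')) -!(dist1_sym (h _)); lra.
have contG : continuity G.
  move=> s eps eps0.
  have [d [d0 Hd]] := dist1_continuous (g s) cg s eps0.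
  exists d; split=> // x Hx; have := Hd x Hx; rewrite /= /Rdist.
  have -> : dist1 (g s) (g s) = 0%Re by rewrite /dist1; split_Rabs; lra.
  have := G_le s x; have := G_le x s; rewrite (dist1_sym (g s)).
  by split_Rabs; lra.
have [s0 [Hs0 s01]] := continuity_ab_min G 0%Re 1%Re le01 (fun c _ => contG c).
exists (G s0); last first.
  move=> s t hs ht; have := Hs0 s hs; have [/(_ t ht)] := HT s.
  by rewrite /G !(dist1_sym (g s)); lra.
have := dis s0 (T s0) s01 (proj2 (HT s0)); rewrite /G /dist1.
case: (g s0) (h (T s0)) => [a b] [c d] ne /=.
case: (Req_dec_T a c) => [ac|]; last by split_Rabs; lra.
case: (Req_dec_T b d) => [bd|]; last by split_Rabs; lra.
by case: ne; rewrite ac bd.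
Qed.

Lemma path_unif_continuous (g : R -> R * R) (eps : R) :
  continuous_path g -> (0 < eps)%Re ->
  exists2 d, (0 < d)%Re & forall s t, (0 <= s <= 1)%Re -> (0 <= t <= 1)%Re ->
    (Rabs (s - t) < d)%Re -> (dist1 (g s) (g t) < eps)%Re.
Proof.
move=> [c1 c2] eps0.
have e2 : (0 < eps / 2)%Re by lra.
have [d1 H1] := Heine_cor2 (fun x _ => c1 x : continuity_pt _ x) (mkposreal _ e2) (a := 0%Re) (b := 1%Re).
have [d2 H2] := Heine_cor2 (fun x _ => c2 x : continuity_pt _ x) (mkposreal _ e2) (a := 0%Re) (b := 1%Re).
exists (Rmin d1 d2); first by apply: Rmin_pos; apply: cond_pos.
move=> s t hs ht st.
have m1 := Rmin_l d1 d2; have m2 := Rmin_r d1 d2.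
have := H1 s t hs ht; have := H2 s t hs ht; rewrite /dist1 /= => k2 k1.
have := k1 ltac:(lra); have := k2 ltac:(lra); lra.
Qed.

(** Otherwise both coordinates change sign weakly from p to q, which puts p no farther from the
    origin than from q. *)
Lemma short_chord_gap p q m :
  (m <= dist1 p (0, 0))%Re -> (dist1 p q < m / 2)%Re -> short_chord p q.
Proof.
case: p q => [a b] [c d]; rewrite /dist1 /short_chord /upper /right /=.
do ! [case: Rlt_dec => /= ? | case: Req_dec_T => /= ?]; move=> h1 h2 //= _;
 split_Rabs; lra.
Qed.

Lemma grid_point_bounds i N : (0 < N)%N -> (i <= N)%N -> (0 <= INR i / INR N <= 1)%Re.
Proof.
move=> N0 iN; have N0' : (0 < INR N)%Re by apply: lt_0_INR; lia.
have i0 := pos_INR i; have iN' : (INR i <= INR N)%Re by apply: le_INR; lia.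
split; first by apply: Rle_mult_inv_pos.
by apply: (Rmult_le_reg_r (INR N)) => //; rewrite /Rdiv Rmult_assoc Rinv_l; lra.
Qed.

(** This is [crossing_grid] for g(s) - h(t). On the two sides with s fixed, [crossing_psub] reverses
    the difference and produces the half-plane terms. *)
Lemma crossings_disjoint_paths (g h : R -> R * R) :
  continuous_path g -> continuous_path h -> disjoint_paths g h ->
  exists N0, forall N, (N0 < N)%N ->
  (crossings N (fun s => psub (g s) (h 0%Re)) - crossings N (fun s => psub (g s) (h 1%Re))
   + crossings N (fun t => psub (h t) (g 1%Re)) - crossings N (fun t => psub (h t) (g 0%Re))
   = (upper (psub (h 1%Re) (g 1%Re)))%:Z - (upper (psub (h 0%Re) (g 1%Re)))%:Z
     - (upper (psub (h 1%Re) (g 0%Re)))%:Z + (upper (psub (h 0%Re) (g 0%Re)))%:Z)%R.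
Proof.
move=> cg ch dis.
have [m m0 gap] := disjoint_paths_gap cg ch dis.
(* Each path moves by less than m/4 in one grid step, so the difference moves by less than m/2. *)
have m4 : (0 < m / 4)%Re by lra.
have [dg dg0 Hg] := path_unif_continuous cg m4.
have [dh dh0 Hh] := path_unif_continuous ch m4.
have [N0 [HN0 N0pos]] := archimed_cor1 (Rmin dg dh) (Rmin_pos _ _ dg0 dh0).
exists N0 => N ltN.
have Npos : (0 < N)%N by lia.
have NR : (0 < INR N)%Re by apply: lt_0_INR; lia.
have HN : (/ INR N < Rmin dg dh)%Re.
  apply: Rle_lt_trans HN0; apply: Rinv_le_contravar; first by apply: lt_0_INR; lia.
  by apply: le_INR; lia.
pose x i := (INR i / INR N)%Re.
have x0 : x 0 = 0%Re by rewrite /x /Rdiv Rmult_0_l.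
have xN : x N = 1%Re by rewrite /x /Rdiv Rinv_r //; lra.
have xstep i i' : (i <= i' <= i.+1)%N -> (Rabs (x i - x i') < Rmin dg dh)%Re.
  move=> lei; have [->|->] : i' = i \/ i' = i.+1 by lia.
    by rewrite Rminus_diag Rabs_R0; apply: Rmin_pos.
  have -> : (x i - x i.+1 = - / INR N)%Re by rewrite /x S_INR; field; lra.
  by rewrite Rabs_Ropp Rabs_pos_eq //; apply: Rlt_le; apply: Rinv_0_lt_compat.
have mg := Rmin_l dg dh; have mh := Rmin_r dg dh.
pose F i j := psub (g (x i)) (h (x j)).
have sc i j i' j' : (i <= i' <= i.+1)%N -> (j <= j' <= j.+1)%N ->
    (i' <= N)%N -> (j' <= N)%N -> short_chord (F i j) (F i' j').
  move=> li lj iN jN.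
  have [bi bi' bj bj'] : [/\ 0 <= x i <= 1, 0 <= x i' <= 1, 0 <= x j <= 1 & 0 <= x j' <= 1]%Re.
    by split; apply: grid_point_bounds; lia.
  have := Hg _ _ bi bi' ltac:(have := xstep _ _ li; lra).
  have := Hh _ _ bj bj' ltac:(have := xstep _ _ lj; lra).
  have := gap _ _ bi bj => gp hh hg.
  apply: (@short_chord_gap _ _ m); first by move: gp; rewrite /dist1 /F /psub /= !Rminus_0_r.
  by move: hh hg; rewrite /dist1 /F /psub /=; split_Rabs; lra.
have side i : (i <= N)%N -> (\sum_(0 <= j < N) crossing (F i j) (F i j.+1) =
    crossings N (fun t => psub (h t) (g (x i)))
    - (upper (psub (h 1%Re) (g (x i))))%:Z + (upper (psub (h 0%Re) (g (x i))))%:Z)%R.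
  move=> iN.
  have ne j : (j <= N)%N -> g (x i) <> h (x j).
    by move=> jN; apply: dis; apply: grid_point_bounds.
  pose u j : int := Posz (upper (F i j)).
  transitivity (crossings N (fun t => psub (h t) (g (x i)))
                + \sum_(0 <= j < N) (u j.+1 - u j))%R.
    rewrite /crossings -big_split /=; apply: eq_big_nat => j /andP[_ jN].
    rewrite /F crossing_psub -?GRing.addrA //; [exact: ne (ltnW jN) | exact: ne |].
    by apply: sc; lia.
  rewrite GRing.telescope_sumr // /u /F (upper_psub (nesym (ne N _))) //.
  by rewrite (upper_psub (nesym (ne 0%N _))) // x0 xN; lia.
have base j : (\sum_(0 <= i < N) crossing (F i j) (F i.+1 j))%R
    = crossings N (fun s => psub (g s) (h (x j))) by [].
have := crossing_grid sc; rewrite !base !side // x0 xN; lia.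
Qed.

(** * Nonplanarity of K_{3,3} *)

Lemma planar_edges_disjoint n (e : rel 'I_n)
    (pt : 'I_n -> R * R) (arc : 'I_n -> 'I_n -> R -> R * R) :
  (forall u v, pt u = pt v -> u = v) ->
  (forall u v, e u v ->
     arc u v R0 = pt u /\ arc u v R1 = pt v /\
     continuity (fun t => fst (arc u v t)) /\
     continuity (fun t => snd (arc u v t)) /\
     (forall s t, (Rle R0 s /\ Rle s R1) -> (Rle R0 t /\ Rle t R1) ->
        arc u v s = arc u v t -> s = t) /\
     (forall w t, (Rlt R0 t /\ Rlt t R1) -> arc u v t <> pt w)) ->
  (forall u v u' v', e u v -> e u' v' ->
     ~ ((u = u' /\ v = v') \/ (u = v' /\ v = u')) ->
     forall s t, (Rlt R0 s /\ Rlt s R1) -> (Rlt R0 t /\ Rlt t R1) ->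
       arc u v s <> arc u' v' t) ->
  forall u v u' v', e u v -> e u' v' -> uniq [:: u; v; u'; v'] ->
    disjoint_paths (arc u v) (arc u' v').
Proof.
move=> inj arcP cross u v u' v' uv uv' /=.
rewrite !inE !negb_or => /and4P[/and3P[/eqP n1 /eqP n2 /eqP n3] /andP[/eqP n4 /eqP n5] /eqP n6 _].
have [g0 [g1 [_ [_ [_ gw]]]]] := arcP _ _ uv.
have [h0 [h1 [_ [_ [_ hw]]]]] := arcP _ _ uv'.
have bd x : (0 <= x <= 1)%Re -> [\/ x = 0%Re, x = 1%Re | (0 < x < 1)%Re].
  move=> hx; case: (Req_dec_T x 0) => [|x0]; first by constructor 1.
  case: (Req_dec_T x 1) => [|x1]; first by constructor 2.
  by constructor 3; lra.
move=> s t /bd[->|->|hs] /bd[->|->|ht]; rewrite ?g0 ?g1 ?h0 ?h1.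
- by move/inj.
- by move/inj.
- by move/esym; apply: hw.
- by move/inj.
- by move/inj.
- by move/esym; apply: hw.
- exact: gw.
- exact: gw.
- by apply: cross => // -[[] // | []].
Qed.

(* In the sum of the relations over i < l and all j != k every wa and wb occurs
   twice, AA, AB and BA occur an even number of times, and the BB terms
   contribute 3 for each of the three pairs {j, k}. *)
Lemma K33_parity (wa wb : 'I_3 -> 'I_3 -> 'I_3 -> int) (AA AB BA BB : 'I_3 -> 'I_3 -> int) :
  (forall i l j k, i != l -> j != k ->
    wa i j l - wb i j k + wb l k j - wa l k i
    = BB k j - AB l j - BA k i + AA l i)%R ->
  (forall j k, j != k -> BB k j = 1 - BB j k)%R -> False.
Proof.
move=> rel flip.
pose o0 := @Ordinal 3 0 isT; pose o1 := @Ordinal 3 1 isT; pose o2 := @Ordinal 3 2 isT.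
have f01 := flip o0 o1 isT; have f02 := flip o0 o2 isT; have f12 := flip o1 o2 isT.
have rels j k (jk : j != k) := (rel o0 o1 j k isT jk, rel o0 o2 j k isT jk, rel o1 o2 j k isT jk).
have [[r1 r2] r3] := rels o0 o1 isT.
have [[r4 r5] r6] := rels o0 o2 isT.
have [[r7 r8] r9] := rels o1 o2 isT.
have [[s1 s2] s3] := rels o1 o0 isT.
have [[s4 s5] s6] := rels o2 o0 isT.
have [[s7 s8] s9] := rels o2 o1 isT.
clear rel flip rels.
lia.
Qed.

Theorem K33_not_planar n (e : rel 'I_n) (a b : 'I_3 -> 'I_n) :
  injective a -> injective b -> (forall i j, a i != b j) ->
  (forall i j, e (a i) (b j)) -> ~ planar e.
Proof.
move=> inja injb ab eab [pt [arc [inj [arcP cross]]]].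
have dis := planar_edges_disjoint inj arcP cross.
have cont i j : continuous_path (arc (a i) (b j)).
  by have [_ [_ [c1 [c2 _]]]] := arcP _ _ (eab i j).
have arc0 i j : arc (a i) (b j) 0%Re = pt (a i) by case: (arcP _ _ (eab i j)).
have arc1 i j : arc (a i) (b j) 1%Re = pt (b j) by case: (arcP _ _ (eab i j)) => _ [].
pose U u v : int := Posz (upper (psub (pt u) (pt v))).
pose w N i j u := crossings N (fun s => psub (arc (a i) (b j) s) (pt u)).
(* The index conditions stand inside the statement, so that x ranges over a finite type and the
   maximum of the thresholds serves all relations. *)
have ex (x : 'I_3 * 'I_3 * ('I_3 * 'I_3)) : exists N0, forall N, (N0 < N)%N ->
   let: (i, l, (j, k)) := x in i != l -> j != k ->
   (w N i j (a l) - w N i j (b k) + w N l k (b j) - w N l k (a i)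
     = U (b k) (b j) - U (a l) (b j) - U (b k) (a i) + U (a l) (a i))%R.
  case: x => [[i l] [j k]].
  case: (boolP ((i != l) && (j != k))) => [/andP[il jk]|no]; last first.
    by exists 0%N => N _ il jk; rewrite il jk in no.
  have u4 : uniq [:: a i; b j; a l; b k].
    by rewrite /= !inE !negb_or !ab (inj_eq inja) [b j == b k](inj_eq injb) il jk eq_sym ab.
  have [N0 HN0] := crossings_disjoint_paths (cont i j) (cont l k) (dis _ _ _ _ (eab i j) (eab l k) u4).
  exists N0 => N /HN0 + _ _.
  by rewrite !arc0 !arc1.
have [f Hf] := fin_all_exists ex.
pose N := (\max_x f x).+1.
have HN x : (f x < N)%N by rewrite ltnS leq_bigmax.
apply: (@K33_parity (fun i j l => w N i j (a l)) (fun i j k => w N i j (b k))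
  (fun l i => U (a l) (a i)) (fun l j => U (a l) (b j)) (fun k i => U (b k) (a i))
  (fun k j => U (b k) (b j))).
- by move=> i l j k; apply: (Hf (i, l, (j, k))).
- move=> j k jk; apply: upper_psub => /inj /injb jk'.
  by rewrite jk' eqxx in jk.
Qed.

(** * Lower bound: the graph K_{2,n-2} *)

Definition K2_rel n : rel 'I_n := fun u v => (u < 2)%N != (v < 2)%N.

Lemma K2_simple n : simple_graph (@K2_rel n).
Proof. by split=> u; rewrite /K2_rel ?eqxx // => v; rewrite eq_sym. Qed.

Lemma K2_num_edges n : (2 * n - 4 <= num_edges (@K2_rel n))%N.
Proof.
case: n => [|[|n]] //; rewrite /num_edges.
pose f (x : 'I_2 * 'I_n) : 'I_n.+2 * 'I_n.+2 := (@lshift 2 n x.1, @rshift 2 n x.2).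
have injf : injective f.
  by move=> [i j] [i' j'] [/= ii' jj']; congr pair; apply: ord_inj; lia.
have -> : 2 * n.+2 - 4 = #|[set f x | x : 'I_2 * 'I_n]|.
  by rewrite card_imset // card_prod !card_ord; lia.
apply: subset_leq_card; apply/subsetP => _ /imsetP[[i j] _ ->].
rewrite inE /K2_rel /=; have := ltn_ord i; lia.
Qed.

(** One end of the backbone is not a hub. Its neighbours are among the two hubs, yet it would need
    at least three. *)
Lemma K2_star_free n m k : (1 < m)%N -> (1 < k)%N ->
  ~ contains_double_star m k (@K2_rel n).
Proof.
move=> m1 k1 [x [y [A [B [sA [sB [un [exy [eA eB]]]]]]]]].
have two (s : seq 'I_n) (u v : 'I_n) : (1 < size s)%N -> uniq (u :: s) -> ~~ (v < 2)%N ->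
    (forall z, z \in u :: s -> K2_rel v z) -> False.
  case: s => [//|p [//|q s]] _ /= /andP[]; rewrite !inE !negb_or.
  move=> /and3P[up uq _] /andP[/andP[pq _] _] v2 H.
  have Hz z : z \in [:: u, p, q & s] -> (z < 2)%N.
    by move/H; rewrite /K2_rel (negbTE v2); case: (z < 2)%N.
  have := Hz u; have := Hz p; have := Hz q; rewrite !inE !eqxx !orbT => hq hp hu.
  have := hq isT; have := hp isT; have := hu isT.
  move: up uq pq; rewrite -!(inj_eq (@ord_inj n)); lia.
case: (boolP (x < 2)%N) => x2.
- apply: (@two B x y) => //; first by rewrite sB.
  + move: un; rewrite /= inE mem_cat !negb_or cat_uniq.
    by move=> /andP[/and3P[_ _ ->]] /andP[_] /and3P[].
  + by move: exy; rewrite /K2_rel x2; case: (y < 2)%N.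
  + move=> z; rewrite inE => /orP[/eqP->|/eB//].
    by have [sym _] := K2_simple n; rewrite sym.
- apply: (@two A y x) => //; first by rewrite sA.
  + move: un; rewrite /= mem_cat !negb_or cat_uniq.
    by move=> /andP[_] /andP[/andP[-> _]] /and3P[].
  + by move=> z; rewrite inE => /orP[/eqP->|/eA//].
Qed.

(* The two hubs sit at height 1 and -1, the other vertices on the x-axis. *)
Definition K2_point n (u : 'I_n) : R * R :=
  if (u < 2)%N then (0, if u == 0%N :> nat then 1 else -1)%Re else (INR u, 0%Re).

Definition K2_arc n (u v : 'I_n) (t : R) : R * R :=
  let p := K2_point u in let q := K2_point v in
  ((1 - t) * p.1 + t * q.1, (1 - t) * p.2 + t * q.2)%Re.

Lemma K2_planar n : planar (@K2_rel n).
Proof.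
have hub (u : 'I_n) : (u < 2)%N -> u = 0%N :> nat \/ u = 1%N :> nat by lia.
have coord (u v : 'I_n) : K2_rel u v -> exists (c : 'I_n) (l : 'I_n) (b : bool),
    [/\ (c < 2)%N, (2 <= l)%N, (u, v) = (if b then (c, l) else (l, c)) &
     forall t, (0 < t < 1)%Re -> exists2 r, (0 < r < 1)%Re &
       K2_arc u v t = (r * INR l, (1 - r) * (if c == 0%N :> nat then 1 else -1))%Re].
  rewrite /K2_rel /K2_arc /K2_point.
  case u2 : (u < 2)%N; case v2 : (v < 2)%N => // _.
  - exists u, v, true; split=> //; first lia.
    by move=> t ht; exists t => //; congr pair => /=; lra.
  - exists v, u, false; split=> //; first lia.
    by move=> t ht; exists (1 - t)%Re; [lra | congr pair => /=; lra].
exists (@K2_point n), (@K2_arc n); split; [|split].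
- move=> u v; rewrite /K2_point => E; apply: ord_inj; move: E.
  case u2 : (u < 2)%N; case v2 : (v < 2)%N.
  + case: (hub u u2) => ->; case: (hub v v2) => -> //= -[]; lra.
  + by case: eqP => _ [_]; lra.
  + by case: eqP => _ [_]; lra.
  + by case=> /INR_eq.
- move=> u v uv; split; [|split; [|split; [|split; [|split]]]].
  + by rewrite /K2_arc; case: (K2_point u) => a b; congr pair => /=; lra.
  + by rewrite /K2_arc; case: (K2_point v) => a b; congr pair => /=; lra.
  + by rewrite /K2_arc /=; reg.
  + by rewrite /K2_arc /=; reg.
  + move=> s t _ _ [_]; move: uv; rewrite /K2_rel /K2_point.
    case u2 : (u < 2)%N; case v2 : (v < 2)%N => //= _; case: eqP => _; lra.
  + move=> w t ht; have [c [l [b [c2 l2 _ H]]]] := coord _ _ uv.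
    have [r hr ->] := H t ht; rewrite /K2_point.
    case: (w < 2)%N => -[]; last by case: eqP => _ _; lra.
    have l0 : (0 < INR l)%Re by apply: lt_0_INR; lia.
    have := Rmult_lt_0_compat r (INR l) ltac:(lra) l0; lra.
- move=> u v u' v' uv uv' ne s t hs ht E.
  have [c [l [b [c2 l2 eq H]]]] := coord _ _ uv.
  have [c' [l' [b' [c2' l2' eq' H']]]] := coord _ _ uv'.
  have [r hr] := H s hs; have [r' hr'] := H' t ht.
  rewrite E => -> -[E1 E2].
  (* The sign of the ordinate determines the hub and its size determines r; the abscissa then
     determines the other end. *)
  have [cc rr] : c = c' /\ r = r'.
    have [c0|c1] := hub c c2; have [c0'|c1'] := hub c' c2'; move: E2;
      rewrite ?c0 ?c1 ?c0' ?c1' /= => E2; try (exfalso; lra);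
      by split; [apply: ord_inj; lia | lra].
  have ll : l = l'.
    apply: ord_inj; apply: INR_eq; apply: (Rmult_eq_reg_l r); last lra.
    by rewrite {2}rr.
  apply: ne; move: eq eq'; rewrite cc ll; case: b b' => -[] [-> ->] [-> ->]; tauto.
Qed.

(** * Upper bound for planar S_{2,3}-free graphs *)

Lemma K33_list_not_planar n (e : rel 'I_n) a1 a2 a3 b1 b2 b3 :
  uniq [:: a1; a2; a3; b1; b2; b3] ->
  (forall a b, a \in [:: a1; a2; a3] -> b \in [:: b1; b2; b3] -> e a b) ->
  ~ planar e.
Proof.
rewrite -[_ :: _]/([:: a1; a2; a3] ++ [:: b1; b2; b3]) cat_uniq.
move=> /and3P[ua /hasPn dis ub] eab.
apply: (@K33_not_planar n e (tnth [tuple a1; a2; a3]) (tnth [tuple b1; b2; b3])).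
- exact/tuple_uniqP.
- exact/tuple_uniqP.
- move=> i j; apply/eqP => E.
  by have := dis _ (mem_tnth j [tuple b1; b2; b3]); rewrite -E /= (mem_tnth i [tuple a1; a2; a3]).
- by move=> i j; apply: eab; apply: mem_tnth.
Qed.

Section Neighbourhoods.
Variables (n : nat) (e : rel 'I_n).
Hypothesis simple_e : simple_graph e.

Definition nbhd (u : 'I_n) : {set 'I_n} := [set v | e u v].

Definition deg (u : 'I_n) : nat := #|nbhd u|.

(** By symmetry of [e], such a set is a union of connected components. *)
Definition adj_closed (W : {set 'I_n}) : Prop := forall u, u \in W -> nbhd u \subset W.

Let e_sym u v : e u v = e v u. Proof. by case: simple_e. Qed.

Let e_irr u : e u u = false. Proof. by case: simple_e. Qed.

Lemma deg_sum (u : 'I_n) (W : {set 'I_n}) :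
  nbhd u \subset W -> deg u = \sum_(v in W) e u v.
Proof.
move=> sub; rewrite /deg -sum1_card [RHS](big_setID (nbhd u)) /= (setIidPr sub).
rewrite [X in _ = _ + X]big1 ?addn0; last first.
  by move=> v; rewrite !inE => /andP[/negbTE-> _].
by apply: eq_bigr => v; rewrite inE => ->.
Qed.

Lemma handshake : \sum_u deg u = 2 * num_edges e.
Proof.
have -> : \sum_u deg u = \sum_u \sum_v (e u v : nat).
  by apply: eq_bigr => u _; rewrite (deg_sum (subsetT _)); apply: eq_bigl => v; rewrite inE.
have E : num_edges e = \sum_(u : 'I_n) \sum_(v : 'I_n) ((u < v) && e u v : nat).
  rewrite /num_edges -sum1_card big_mkcond pair_bigA /=.
  by apply: eq_bigr => p _; rewrite inE; case: ifP.
rewrite mul2n -addnn {1}E E [X in _ = _ + X]exchange_big /= -big_split /=.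
apply: eq_bigr => u _; rewrite -big_split /=; apply: eq_bigr => v _.
rewrite (e_sym v u); case: (ltngtP u v) => [||/ord_inj->] /=; rewrite ?addn0 //.
by rewrite e_irr.
Qed.

(** The leaves at x are fixed first; any k of the remaining neighbours of y then serve as its
    leaves. *)
Lemma double_starI m k x y (A : {set 'I_n}) :
  e x y -> A \subset nbhd x :\ y -> #|A| = m -> k <= #|(nbhd y :\ x) :\: A| ->
  contains_double_star m k e.
Proof.
move=> exy /subsetP sA cA ck.
exists x, y, (enum A), (take k (enum ((nbhd y :\ x) :\: A))).
have inB z : z \in take k (enum ((nbhd y :\ x) :\: A)) -> [/\ z \notin A, z != x & e y z].
  by move/mem_take; rewrite mem_enum !inE => /and3P[].
have inA z : z \in enum A -> z != y /\ e x z.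
  by rewrite mem_enum => /sA; rewrite !inE => /andP[].
split; first by rewrite -cardE.
split; first by rewrite size_take -cardE; case: ltngtP ck.
split; last first.
  by split=> //; split=> z; [case/inA | case/inB].
rewrite /= inE !mem_cat !negb_or cat_uniq enum_uniq take_uniq ?enum_uniq //= andbT.
apply/and3P; split.
- apply/and3P; split.
  + by apply/eqP => E; rewrite E e_irr in exy.
  + by apply/negP => /inA[_]; rewrite e_irr.
  + by apply/negP => /inB[_]; rewrite eqxx.
- apply/andP; split.
  + by apply/negP => /inA[]; rewrite eqxx.
  + by apply/negP => /inB[_ _]; rewrite e_irr.
- by apply/hasPn => z /inB[zA _ _]; rewrite /= mem_enum.
Qed.

Hypothesis star_free : ~ contains_double_star 2 3 e.

(** Two further neighbours of x would be its leaves; y loses x and at most these two, and keeps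
    three leaves. *)
Lemma deg_nbr_of_deg_ge6 y x : 6 <= deg y -> e y x -> deg x <= 2.
Proof.
move=> dy yx; rewrite leqNgt; apply/negP => dx; apply: star_free.
have xy : e x y by rewrite e_sym.
have /card_gt1P[p [q [hp hq pq]]] : 1 < #|nbhd x :\ y|.
  by move: dx; rewrite /deg (cardsD1 y) inE xy.
apply: (@double_starI 2 3 x y [set p; q]) => //.
- by apply/subsetP => z; rewrite inE => /orP[] /set1P->.
- by rewrite cards2 pq.
- have := cardsID [set p; q] (nbhd y :\ x).
  have := subset_leq_card (subsetIr (nbhd y :\ x) [set p; q]).
  move: dy; rewrite /deg (cardsD1 x) inE yx cards2 pq; set A := #|nbhd y :\ x|; set B := #|_ :\: [set p; q]|; set C := #|_ :&: _|; lia.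
Qed.

(** A neighbour z of x outside N[y] is a leaf that costs y nothing. A second leaf q costs at most
    one, so y keeps 5 - 1 - 1 = 3. *)
Lemma nbhd_nbr_of_deg5 y x :
  deg y = 5 -> e y x -> 3 <= deg x -> nbhd x \subset y |: nbhd y.
Proof.
move=> dy yx dx; apply/subsetP => z xz; apply/negPn/negP.
rewrite !inE negb_or => /andP[zy yz]; apply: star_free.
have xy : e x y by rewrite e_sym.
have /card_gt0P[q] : 0 < #|nbhd x :\ y :\ z|.
  move: dx; rewrite /deg (cardsD1 y) inE xy (cardsD1 z (nbhd x :\ y)) in_setD1 zy xz; lia.
rewrite !inE => /and3P[qz qy xq].
apply: (@double_starI 2 3 x y [set z; q]) => //.
- apply/subsetP => w; rewrite !inE.
  by case/orP=> /eqP->; rewrite ?zy ?qy //; rewrite inE in xz.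
- by rewrite cards2 eq_sym qz.
- have -> : (nbhd y :\ x) :\: [set z; q] = nbhd y :\ x :\ q.
    apply/setP => w; rewrite !inE negb_or.
    by case: (eqVneq w z) => [->|] /=; rewrite ?(negbTE yz) ?andbF.
  move: dy; rewrite /deg (cardsD1 x) inE yx (cardsD1 q (nbhd y :\ x)).
  case: (q \in _); lia.
Qed.

Definition small_nbrs (v : 'I_n) : nat := #|[set u in nbhd v | deg u <= 2]|.

(* Each vertex of degree at most 2 sends charge -1 along each of its edges. *)
Lemma discharging (W : {set 'I_n}) :
  adj_closed W -> (forall v, v \in W -> deg v = 5 -> 0 < small_nbrs v) ->
  \sum_(v in W) deg v <= 4 * #|W|.
Proof.
move=> clW good.
(* Degree at most 2 leaves 2 to spare below 4, degree 5 needs one small neighbour, and from degree 6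
   on all neighbours are small. *)
have local v : v \in W ->
    deg v + 2 * (deg v <= 2) <= 4 + \sum_(u in W) (e v u && (deg u <= 2)).
  move=> vW.
  have -> : \sum_(u in W) (e v u && (deg u <= 2)) = small_nbrs v.
    rewrite /small_nbrs -sum1_card big_mkcond [RHS]big_mkcond /=.
    apply: eq_bigr => u _; rewrite !inE.
    case: (boolP (e v u)) => [vu|]; last by rewrite if_same.
    have -> : u \in W by apply: (subsetP (clW v vW)); rewrite inE.
    by case: leqP.
  have [d6|d5] := leqP 6 (deg v).
    have -> : small_nbrs v = deg v.
      apply: eq_card => u; rewrite !inE; case: (boolP (e v u)) => //= vu.
      exact: deg_nbr_of_deg_ge6 d6 vu.
    lia.
  have [d5'|d5'] := eqVneq (deg v) 5; first by have := good v vW d5'; lia.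
  by case: leqP; lia.
have global : \sum_(v in W) \sum_(u in W) (e v u && (deg u <= 2))
    <= \sum_(v in W) 2 * (deg v <= 2).
  rewrite exchange_big /=; apply: leq_sum => u uW.
  case: (leqP (deg u) 2) => du; last by rewrite big1 // => v _; rewrite andbF.
  rewrite muln1; apply: leq_trans du; rewrite (deg_sum (clW u uW)).
  by apply: leq_sum => v _; rewrite andbT e_sym.
rewrite -(leq_add2r (\sum_(v in W) 2 * (deg v <= 2))).
apply: (@leq_trans (4 * #|W| + \sum_(v in W) \sum_(u in W) (e v u && (deg u <= 2)))).
  by rewrite mulnC -sum_nat_const -!big_split; apply: leq_sum.
by rewrite leq_add2l.
Qed.

Hypothesis planar_e : planar e.

(** A sum of at least 25 leaves at least 25 - 5 - 5 = 15 for the degrees inside N(v), hence 8 edges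
    there and a K_{2,3}; v joins its side of two to give K_{3,3}. *)
Lemma planar_wheel_deg_sum v :
  deg v = 5 -> adj_closed (v |: nbhd v) -> \sum_(u in v |: nbhd v) deg u <= 24.
Proof.
move=> dv cl; rewrite leqNgt; apply/negP.
have vN : v \notin nbhd v by rewrite inE e_irr.
have [s [us ss ins]] : exists s, [/\ uniq s, size s = 5 & s =i nbhd v].
  by exists (enum (nbhd v)); rewrite enum_uniq -cardE; split=> // u; rewrite mem_enum.
have sumN (F : 'I_n -> nat) : \sum_(u in nbhd v) F u = \sum_(u <- s) F u.
  by rewrite big_uniq //=; apply: eq_bigl => u; rewrite ins.
have K p q x y z : perm_eq [:: p; q; x; y; z] s ->
    [&& e p x, e p y, e p z, e q x, e q y & e q z] = false.
  move=> ps; apply/negP => /and5P[px py pz qx /andP[qy qz]].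
  have inv w : w \in [:: p; q; x; y; z] -> e v w.
    by rewrite (perm_mem ps) ins inE.
  apply: (@K33_list_not_planar n e v p q x y z) planar_e.
    rewrite cons_uniq (perm_uniq ps) us andbT (perm_mem ps) ins //.
  move=> a b; rewrite !inE => /or3P[]/eqP-> /or3P[]/eqP-> //;
    by apply: inv; rewrite !inE eqxx ?orbT.
rewrite big_setU1 //= dv sumN.
have degE u : u \in s -> deg u = 1 + \sum_(w <- s) e u w.
  rewrite ins => vu; rewrite (deg_sum (cl u _)); last by rewrite in_setU1 vu orbT.
  by rewrite big_setU1 //= sumN e_sym; move: vu; rewrite inE => ->.
rewrite big_seq (eq_bigr _ degE) -big_seq {degE sumN cl}.
move: s us ss ins K => [|a [|b [|c [|d [|f [|]]]]]] // us _ _ K.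
rewrite !big_cons !big_nil !e_irr.
(* Stated by counts, each permutation condition becomes linear arithmetic. *)
have {}K p q x y z (P : forall Q : pred 'I_n,
    count Q [:: p; q; x; y; z] = count Q [:: a; b; c; d; f]) := K p q x y z (introT permP P).
(* Every graph on 5 vertices with at least 8 edges contains K_{2,3}. *)
have := K a b c d f ltac:(move=> ? /=; lia).
have := K a c b d f ltac:(move=> ? /=; lia).
have := K a d b c f ltac:(move=> ? /=; lia).
have := K a f b c d ltac:(move=> ? /=; lia).
have := K b c a d f ltac:(move=> ? /=; lia).
have := K b d a c f ltac:(move=> ? /=; lia).
have := K b f a c d ltac:(move=> ? /=; lia).
have := K c d a b f ltac:(move=> ? /=; lia).
have := K c f a b d ltac:(move=> ? /=; lia).
have := K d f a b c ltac:(move=> ? /=; lia).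
(* With each pair written in one order, ten booleans remain, and all 2^10 graphs are checked. *)
rewrite ?(e_sym b a) ?(e_sym c a) ?(e_sym d a) ?(e_sym f a) ?(e_sym c b).
rewrite ?(e_sym d b) ?(e_sym f b) ?(e_sym d c) ?(e_sym f c) ?(e_sym f d).
rewrite {K us}.
do 10! case: (e _ _); by [].
Qed.

(* A vertex of degree 5 without neighbours of degree at most 2 spans a
   connected component on 6 vertices; such components are split off first. *)
Lemma adj_closed_deg_sum (W : {set 'I_n}) :
  adj_closed W -> \sum_(v in W) deg v <= 4 * #|W|.
Proof.
have [k] := ubnP #|W|; elim: k W => // k IH W ltW clW.
case: (boolP [exists v in W, (deg v == 5) && (small_nbrs v == 0)]); last first.
  move=> /exists_inPn good; apply: discharging => // v vW dv.
  by have := good v vW; rewrite dv eqxx lt0n.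
case/exists_inP=> v vW /andP[/eqP dv /eqP sv].
pose C := v |: nbhd v.
have clC : adj_closed C.
  move=> u; rewrite in_setU1 => /orP[/eqP->|vu]; first exact: subsetUr.
  apply: nbhd_nbr_of_deg5 => //; first by rewrite inE in vu.
  rewrite ltnNge; apply/negP => du.
  by have /setP/(_ u) := cards0_eq sv; rewrite in_set vu du in_set0.
have sCW : C \subset W by rewrite subUset sub1set vW clW.
have clD : adj_closed (W :\: C).
  move=> u; rewrite inE => /andP[uC uW]; apply/subsetP => w uw.
  rewrite inE (subsetP (clW u uW) w uw) andbT.
  apply: contra uC => wC; apply: (subsetP (clC w wC)).
  by move: uw; rewrite !inE e_sym.
have cardC : #|C| = 6 by rewrite cardsU1 inE e_irr -/(deg v) dv.
have cardD : #|C| + #|W :\: C| = #|W|.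
  by rewrite -(cardsID C W) (setIidPr sCW).
have -> : 4 * #|W| = 24 + 4 * #|W :\: C| by rewrite -cardD cardC mulnDr.
rewrite (big_setID C) /= (setIidPr sCW); apply: leq_add.
  exact: planar_wheel_deg_sum.
by apply: IH clD; move: ltW; rewrite -cardD cardC; lia.
Qed.

Lemma num_edges_star_free : num_edges e <= 2 * n.
Proof.
have cl : adj_closed setT by move=> u _; apply: subsetT.
have := adj_closed_deg_sum cl; rewrite cardsT card_ord.
have -> : \sum_(v in [set: 'I_n]) deg v = 2 * num_edges e.
  by rewrite -handshake; apply: eq_bigl => v; rewrite inE.
lia.
Qed.

End Neighbourhoods.

(** * Existence of the maximum and the two bounds *)

(** Passing to a larger member decreases b - k; excluded middle decides whether there is one. *)
Lemma bounded_nat_max (P : nat -> Prop) (k b : nat) :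
  P k -> (forall m, P m -> m <= b) -> exists m, P m /\ forall m', P m' -> m' <= m.
Proof.
move=> Pk bP; have [j] := ubnP (b - k); elim: j k Pk => // j IH k Pk ltj.
case: (classic (exists2 m, P m & k < m)) => [[m Pm km]|no].
  by apply: (IH m) => //; have := bP m Pm; lia.
exists k; split=> // m Pm; rewrite leqNgt; apply/negP => km; apply: no.
by exists m.
Qed.

Theorem theorem1p1 (n : nat) (hn : (1 <= n)%N) :
  exists m : nat, is_planar_turan_double_star 2 3 n m /\
    (2 * n - 4 <= m)%N /\ (m <= 2 * n)%N.
Proof.
pose P m := exists e : rel 'I_n, simple_graph e /\ planar e /\
  ~ contains_double_star 2 3 e /\ num_edges e = m.
have PK : P (num_edges (@K2_rel n)).
  exists (@K2_rel n); split; first exact: K2_simple.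
  by split; [exact: K2_planar | split=> //; apply: K2_star_free].
have P2n m : P m -> m <= 2 * n.
  by case=> e [se [pe [fe <-]]]; apply: num_edges_star_free.
have [m [Pm maxm]] := bounded_nat_max PK P2n.
exists m; split; last by split; [exact: leq_trans (K2_num_edges n) (maxm _ PK) | exact: P2n].
by split=> // e se pe fe; apply: maxm; exists e.
Qed.
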